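(* We have the following formula for the series $\Psi(q,t,z)$: $$\Psi(q,t,z)=e^t\prod_{i\ge3}e^{\,z\,q\,[i-2]_q\,\frac{t^i}{i!}},$$ where $[j]_q$ denotes the $q$-analog of $j$: $[j]_q=1+q+\cdots+q^{j-1}$.
   Context: Irreducibles and nested sets. For $n\ge2$ let $V=\{x\in\mathbb C^n:\sum_i x_i=0\}$. For $I\subseteq\{1,\dots,n\}$, $|I|\ge2$, let $A_I$ be the span of all $e_i-e_j$, $i,j\in I$ (so $\dim A_I=|I|-1$); put $\mathcal F_{A_{n-1}}=\{A_I\}$, so $V=A_{\{1,\dots,n\}}$. A set $\mathcal S\subseteq\mathcal F_{A_{n-1}}$ is nested if for any $A_I,A_J\in\mathcal S$ either $I\cap J=\emptyset$ or one of $I,J$ contains the other; the empty set is regarded as nested here, and nested sets are not required to contain $V$. Yuzvinsky basis. Let $Y_{\mathcal F_{A_{n-1}}}$ be the complex minimal De Concini–Procesi model of type $A_{n-1}$, i.e. the closure of the image of $\mathbb P(\mathcal M)\to\mathbb P(V)\times\prod_{D\in\mathcal F_{A_{n-1}}\setminus\{V\}}\mathbb P(V/D^\perp)$, $\mathcal M$ being the complement in $V$ of the hyperplanes $x_i=x_j$ (it is isomorphic to $\overline M_{0,n+1}$). A function $f:\mathcal F_{A_{n-1}}\to\mathbb N$ is admissible if $f=0$, or if its support $\mathrm{supp}\,f$ is nested and for every $A\in\mathrm{supp}\,f$ $$f(A)<\dim A-\dim\Big(\sum_{B\in\mathrm{supp} f,\ B\subsetneq A}B\Big).$$ The monomials $m_f=\prod_Ac_A^{f(A)}$,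 $f$ admissible, in certain degree-$2$ classes $c_A\in H^2(Y_{\mathcal F_{A_{n-1}}},\mathbb Z)$ (for $A\neq V$, the class of the boundary divisor $\mathcal D_A$) form a $\mathbb Z$-basis of $H^*(Y_{\mathcal F_{A_{n-1}}},\mathbb Z)$, the Yuzvinsky basis; $m_f\in H^{2\sum_Af(A)}$. The series $\Psi$. For a nested set $\mathcal S\subseteq\mathcal F_{A_{n-1}}$ let $$P(\mathcal S)=\sum_{f\text{ admissible},\ \mathrm{supp} f=\mathcal S}q^{\sum_Af(A)}$$ (the contribution to the Poincaré polynomial of $Y_{\mathcal F_{A_{n-1}}}$, with $H^{2i}$ counted by $q^i$, of the basis monomials $m_f$ with $\mathrm{supp}\,f=\mathcal S$; thus $P(\emptyset)=1$). Define the formal power series $$\Psi(q,t,z)=1+\sum_{n\ge2}\ \sum_{\mathcal S}P(\mathcal S)\,z^{|\mathcal S|}\,\frac{t^{\,n+|\mathcal S|-1}}{(n+|\mathcal S|-1)!},$$ where, for each $n$, $\mathcal S$ ranges over all the nested sets of $\mathcal F_{A_{n-1}}$ (including $\emptyset$). *)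

(* Defs.v *)
From HB Require Import structures.
From mathcomp Require Import all_boot all_order all_algebra.
From mathcomp Require Import complex.
From mathcomp Require Import boolp functions reals.
From mathcomp Require Import mpoly.
From mathcomp Require Import zify.

Set Implicit Arguments.
Unset Strict Implicit.
Unset Printing Implicit Defensive.

Import Order.TTheory GRing.Theory Num.Theory.

Local Open Scope ring_scope.

(** [F : fps A] stands for the series [\sum_N F N * t^N]. *)
Definition fps (A : Type) := nat -> A.

HB.instance Definition _ (A : comNzRingType) :=
  GRing.Zmodule.copy (fps A) (nat -> A).

Section FpsRing.
Variable A : comNzRingType.
Implicit Types F G H : fps A.

Definition fps1 : fps A := fun N => (N == 0%N)%:R.
Definition fps_mul F G : fps A :=
  fun N => \sum_(i < N.+1) F i * G (N - i)%N.
Definition fps_scale (a : A) F : fps A := fun N => a * F N.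

Definition fps_trunc (m : nat) F : {poly A} := \poly_(i < m) F i.

Lemma fps_mul_trunc m F G N : (N < m)%N ->
  fps_mul F G N = (fps_trunc m F * fps_trunc m G)`_N.
Proof.
move=> ltNm; rewrite coefM; apply: eq_bigr => i _.
by rewrite !coef_poly (leq_ltn_trans _ ltNm) ?leq_ord //
  (leq_ltn_trans _ ltNm) ?leq_subr.
Qed.

Lemma fps_mulA : associative fps_mul.
Proof.
move=> F G H; apply/funext => N.
have E m K L K' L' : (forall i, (i <= m)%N -> K i = K' i) ->
    (forall i, (i <= m)%N -> L i = L' i) -> fps_mul K L m = fps_mul K' L' m.
  move=> eK eL; apply: eq_bigr => i _.
  by rewrite eK ?eL ?leq_subr ?leq_ord.
pose c (p : {poly A}) : fps A := fun i => p`_i.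
have cM p r i : fps_mul (c p) (c r) i = (p * r)`_i by rewrite coefM.
pose f := fps_trunc N.+1 F; pose g := fps_trunc N.+1 G.
pose h := fps_trunc N.+1 H.
have cT K i : (i <= N)%N -> K i = c (fps_trunc N.+1 K) i.
  by move=> leiN; rewrite /c coef_poly ltnS leiN.
rewrite (E N F (fps_mul G H) (c f) (c (g * h))) ?cM.
- rewrite mulrA -cM; apply: E => i leiN; last by rewrite -cT.
  by rewrite [RHS](@fps_mul_trunc N.+1).
- by move=> i leiN; apply: cT.
- by move=> i leiN; rewrite (@fps_mul_trunc N.+1).
Qed.

Lemma fps_mulC : commutative fps_mul.
Proof.
by move=> F G; apply/funext=> N; rewrite !(@fps_mul_trunc N.+1) // mulrC.
Qed.

Lemma fps_mul1 : left_id fps1 fps_mul.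
Proof.
move=> F; apply/funext=> N; rewrite /fps_mul big_ord_recl /fps1 eqxx mul1r.
by rewrite subn0 big1 ?addr0 // => i _; rewrite mul0r.
Qed.

Lemma fps_mulDl : left_distributive fps_mul +%R.
Proof.
move=> F G H; apply/funext=> N; rewrite /fps_mul.
have -> : ((F + G : fps A) = fun i => F i + G i) by [].
under eq_bigr do rewrite mulrDl.
by rewrite big_split.
Qed.

Lemma fps1_neq0 : fps1 != 0.
Proof.
by apply/eqP=> /(congr1 (fun F : fps A => F 0%N)) /eqP; rewrite [_ == _]oner_eq0.
Qed.

Lemma fps_scaleA a b F : fps_scale a (fps_scale b F) = fps_scale (a * b) F.
Proof. by apply/funext=> N; rewrite /fps_scale mulrA. Qed.

Lemma fps_scale1 : left_id 1 fps_scale.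
Proof. by move=> F; apply/funext=> N; rewrite /fps_scale mul1r. Qed.

Lemma fps_scaleDr : right_distributive fps_scale +%R.
Proof. by move=> a F G; apply/funext=> N; apply: mulrDr. Qed.

Lemma fps_scaleDl F : {morph fps_scale^~ F : a b / a + b}.
Proof. by move=> a b; apply/funext=> N; apply: mulrDl. Qed.

End FpsRing.

HB.instance Definition _ (A : comNzRingType) :=
  GRing.Zmodule_isComNzRing.Build (fps A) (@fps_mulA A) (@fps_mulC A)
    (@fps_mul1 A) (@fps_mulDl A) (@fps1_neq0 A).
HB.instance Definition _ (A : comNzRingType) :=
  GRing.Zmodule_isLmodule.Build A (fps A) (@fps_scaleA A) (@fps_scale1 A)
    (@fps_scaleDr A) (@fps_scaleDl A).

Section FpsTheory.
Variable A : comNzRingType.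
Implicit Types F G : fps A.

Definition fps_t : fps A := fun N => (N == 1%N)%:R.

(** t-adic convergence: each coefficient is eventually constant. *)
Definition fps_cvg (u : nat -> fps A) F :=
  forall N, exists M, forall m, (M <= m)%N -> u m N = F N.

Lemma fps_coefD F G N : (F + G) N = F N + G N.
Proof. by []. Qed.

Lemma fps_coef1 N : (1 : fps A) N = (N == 0%N)%:R.
Proof. by []. Qed.

Lemma fps_coefM F G N : (F * G) N = \sum_(i < N.+1) F i * G (N - i)%N.
Proof. by []. Qed.

Lemma fps_coefZ a F N : (a *: F) N = a * F N.
Proof. by []. Qed.

Lemma fps_coef_sum I (r : seq I) (P : pred I) (u : I -> fps A) N :
  (\sum_(i <- r | P i) u i) N = \sum_(i <- r | P i) u i N.
Proof. exact: (big_morph (fun F : fps A => F N) (fun F G => fps_coefD F G N)). Qed.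

Lemma fps_coef_tX k N : (fps_t ^+ k) N = (N == k)%:R.
Proof.
elim: k N => [|k IHk] N; first by rewrite expr0 fps_coef1.
rewrite exprS fps_coefM; case: N => [|N].
  by rewrite big_ord1 mul0r.
rewrite !big_ord_recl mul0r add0r mul1r IHk big1 ?addr0 => [|i _].
  by rewrite eqSS /bump /= subn1.
by rewrite mul0r.
Qed.

Lemma fps_expr_ord F k N : F 0%N = 0 -> (N < k)%N -> (F ^+ k) N = 0.
Proof.
move=> F0; elim: k N => // k IHk N leNk; rewrite exprS fps_coefM.
rewrite big_ord_recl F0 mul0r add0r big1 // => i _.
by rewrite IHk ?mulr0 // lift0; have := ltn_ord i; lia.
Qed.

End FpsTheory.

Arguments fps_t {A}.

(** exp F = \sum_k F^k / k!, for F without constant term: only the k <= N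
    contribute to the coefficient of t^N (see [fps_exp_cvg]). *)
Definition fps_exp (A : comAlgType rat) (F : fps A) : fps A :=
  fun N => \sum_(k < N.+1) (k`!%:R^-1 : rat) *: (F ^+ k) N.

Lemma fps_exp_cvg (A : comAlgType rat) (F : fps A) : F 0%N = 0 ->
  fps_cvg (fun m => \sum_(k < m) ((k`!%:R^-1 : rat)%:A : A) *: F ^+ k)
    (fps_exp F).
Proof.
move=> F0 N; exists N.+1 => m leNm; rewrite fps_coef_sum.
rewrite /fps_exp (big_ord_widen m (fun k => (k`!%:R^-1 : rat) *: (F ^+ k) N)) //.
rewrite [RHS]big_mkcond; apply: eq_bigr => k _.
rewrite fps_coefZ mulr_algl; case: ltnP => // ltNk.
by rewrite fps_expr_ord ?scaler0.
Qed.

(** The index I of the subspace A_I; [irr_space_inj] says that I is determined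
    by A_I, so that [irr n] indexes the family F_(A_(n-1)) faithfully. *)
Definition irr (n : nat) := {I : {set 'I_n} | (1 < #|I|)%N}.
HB.instance Definition _ n := SubFinite.copy (irr n) {I : {set 'I_n} | (1 < #|I|)%N}.

Section Irreducibles.
Variables (R : realType) (n : nat).

Definition irr_space (A : irr n) : {vspace 'rV[R[i]]_n} :=
  <<[seq (delta_mx 0 i - delta_mx 0 j)%R | i <- enum (val A), j <- enum (val A)]>>%VS.

Lemma irr_space_inj : injective irr_space.
Proof.
suff sub (A B : irr n) : irr_space A = irr_space B -> val A \subset val B.
  move=> A B eAB; apply: val_inj; apply/eqP.
  by rewrite eqEsubset !sub.
move=> eAB; apply/subsetP => i iA; apply: contraT => iNB.
have [j jA neq_ji] : exists2 j, j \in val A & j != i.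
  have := valP A; rewrite (cardsD1 i) iA ltnS card_gt0 => /set0Pn[j].
  by rewrite !inE => /andP[ne_ji jA]; exists j.
have: delta_mx 0 i - delta_mx 0 j \in irr_space A.
  by apply/memv_span/allpairsP; exists (i, j); rewrite !mem_enum.
rewrite eAB => /(@coord_span _ _ _ (in_tuple _)) e.
have := congr1 (fun v : 'rV_n => v 0 i) e.
rewrite !mxE !eqxx [i == j]eq_sym (negPf neq_ji) subr0 summxE big1.
  by move/eqP; rewrite oner_eq0.
move=> k _; rewrite mxE.
set v := _`_k; have /allpairsP[[a b] /= [aB bB ->]]: v \in
    [seq delta_mx 0 i - delta_mx 0 j | i <- enum (val B), j <- enum (val B)].
  by apply: mem_nth; rewrite ?size_tuple.
rewrite !mem_enum in aB bB.
have ne c : c \in val B -> (i == c) = false.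
  by move=> cB; apply: contraNF iNB => /eqP->.
by rewrite !mxE !ne ?andbF ?subr0 ?mulr0.
Qed.

Definition nested (S : {set irr n}) : bool :=
  [forall A in S, forall B in S,
    [|| [disjoint val A & val B], val A \subset val B | val B \subset val A]].

Definition supp (f : irr n -> nat) : {set irr n} := [set A | f A != 0%N].

(** The sum of the B is contained in A, so the nat subtraction is exact. *)
Definition admissible (f : irr n -> nat) : bool :=
  [forall A, f A == 0%N] ||
  nested (supp f) &&
  [forall A in supp f,
    (f A < \dim (irr_space A)
           - \dim (\sum_(B in supp f |
                       (irr_space B <= irr_space A)%VS
                       && (irr_space B != irr_space A)) irr_space B)%VS)%N].

(** Hence the admissible functions are finitely many, and they can be summed
    over as finite functions with values in ['I_n]. *)
Lemma admissible_lt (f : irr n -> nat) A : admissible f -> (f A < n)%N.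
Proof.
have n_gt0 : (0 < n)%N.
  by rewrite -[n]card_ord (leq_trans _ (max_card (mem (val A)))) // ltnW ?(valP A).
case/orP => [/forallP/(_ A)/eqP-> //|/andP[_ /forall_inP H]].
have [AS|] := boolP (A \in supp f); last by rewrite inE negbK => /eqP->.
apply: leq_trans (H A AS) (leq_trans (leq_subr _ _) _).
by apply: leq_trans (dimvS (subvf _)) _; rewrite dimvf /dim /= mul1n.
Qed.

End Irreducibles.

(** The coefficient of each t^N in Psi is a polynomial in q and z, so Psi lives
    in Q[q,z][[t]]. *)

Definition Qqz : comAlgType rat := {mpoly rat[2]}.
Definition q : Qqz := 'X_(inord 0).
Definition z : Qqz := 'X_(inord 1).

Definition qint (j : nat) : Qqz := \sum_(0 <= i < j) q ^+ i.

Definition Pnest (R : realType) (n : nat) (S : {set irr n}) : Qqz :=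
  \sum_(f : {ffun irr n -> 'I_n} | admissible R (fun A => f A : nat)
                                   && (supp (fun A => f A : nat) == S))
     q ^+ (\sum_A f A)%N.

Definition Psi_term (R : realType) (n : nat) : fps Qqz :=
  \sum_(S : {set irr n} | nested S)
     ((n + #|S| - 1)`!%:R^-1 *: (Pnest R S * z ^+ #|S|)) *: fps_t ^+ (n + #|S| - 1).

(** Only the n <= N + 1 contribute to the coefficient of t^N
    (see [Psi_cvg]). *)
Definition Psi (R : realType) : fps Qqz :=
  fun N => (1 + \sum_(2 <= n < N.+2) Psi_term R n) N.

Lemma Psi_cvg (R : realType) :
  fps_cvg (fun m => 1 + \sum_(2 <= n < m) Psi_term R n) (Psi R).
Proof.
move=> N; exists N.+2 => m leNm; rewrite /Psi !fps_coefD; congr (_ + _).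
rewrite (@big_cat_nat _ _ _ N.+2) //= fps_coefD [X in _ + X]fps_coef_sum.
rewrite [X in _ + X]big_nat_cond [X in _ + X]big1 ?addr0 // => n.
rewrite andbT => /andP[leNn _].
rewrite /Psi_term fps_coef_sum big1 // => S _; rewrite fps_coefZ fps_coef_tX.
by case: eqP => [|_]; [lia | rewrite mulr0].
Qed.

(* Main.v *)
Require Import Defs.
From mathcomp Require Import all_boot all_order all_algebra.
From mathcomp Require Import complex boolp.
From mathcomp Require Import reals.
From mathcomp Require Import zify.

Set Implicit Arguments.
Unset Strict Implicit.
Unset Printing Implicit Defensive.

Import GRing.Theory Num.Theory.

Local Open Scope ring_scope.

(** A nested set S is a forest on the points 1, ..., n.  Its members and the
    points are the nodes, and the children of a member A are the maximal nodes
    strictly inside A.  The sum of the subspaces of the members strictly inside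
    A has codimension (number of children) - 1 in A ([codim_below]), so an
    admissible f with support S chooses freely, for each member A with c
    children, an exponent between 1 and c - 2.  Hence P(S) is the product over
    the members of the weights w_c = q [c-2]_q ([sum_admissible]).  Note that
    w_c = 0 for c <= 2.

    It remains to count forests with a weight w_c on each inner node with c
    children.  Let phi = \sum_c w_c t^c/c!.  The formula says that the weighted
    number of forests with n leaves and k inner nodes is the coefficient of
    t^N/N! in e^t phi^k/k!, where N = n+k-1: these forests are counted by the
    families of k disjoint blocks in a set with N elements, a block of size c
    having the weight w_c.  An induction has to follow the number of trees: let
    Phi_{n,k}(G) be the weighted sum over the forests, each one multiplied by
    the coefficient of t^(r-1)/(r-1)! in G, where r is its number of trees; the
    sum wanted is Phi_{n,k}(e^t).  The claim becomes ([nested_sumE])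

      Phi_{n,k}(G) = coefficient of t^N/N! in G phi^k/k!,   N = n+k-1,

    and it follows from a decomposition of forests which mirrors the Leibniz
    rule (G phi^k/k!)' = G' phi^k/k! + (G phi') phi^(k-1)/(k-1)!.  Fix a point
    x.  If x is a tree on its own, remove it: this lowers r by 1, that is,
    replaces G by G' ([sum_uncovered]).  Otherwise remove the root of the tree
    containing x: this is inverse to choosing, in a forest with k-1 inner
    nodes, a set of at least two trees including the one of x, and joining them
    under a new root.  Summing over the choices amounts to a product of
    exponential generating functions, which replaces G by G phi'
    ([sum_covered]).

    Summing z^k e^t phi^k/k! over k gives e^t exp(z phi), and exp turns the sum
    z phi into the infinite product of the statement. *)

(** * Derivative and exponential of formal power series *)

Section Deriv.
Variable A : comNzRingType.
Implicit Types F G Y : fps A.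

Definition fps_deriv F : fps A := fun N => F N.+1 *+ N.+1.

Lemma fps_derivM F G :
  fps_deriv (F * G) = fps_deriv F * G + F * fps_deriv G.
Proof.
apply/funext=> N; rewrite fps_coefD /fps_deriv !fps_coefM -sumrMnl.
under eq_bigr => i _ do
  rewrite -[X in _ *+ X](subnKC (leq_ord i)) mulrnDr -mulrnAl -mulrnAr.
rewrite big_split /=; congr (_ + _).
  by rewrite big_ord_recl mulr0n mul0r add0r.
rewrite big_ord_recr /= subnn mulr0n mulr0 addr0; apply: eq_bigr => i _.
by rewrite subSn // leq_ord.
Qed.

Lemma fps_derivX F k :
  fps_deriv (F ^+ k.+1) = (F ^+ k * fps_deriv F) *+ k.+1.
Proof.
elim: k => [|k IHk]; first by rewrite mul1r.
rewrite exprS fps_derivM IHk mulrnAr mulrA -exprS [fps_deriv F * _]mulrC.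
by rewrite -mulrS.
Qed.

Lemma fps_expr_val d F k N : (forall i, (i < d)%N -> F i = 0) ->
  (N < d * k)%N -> (F ^+ k) N = 0.
Proof.
move=> F0; elim: k N => [|k IHk] N ltN; first by rewrite muln0 in ltN.
rewrite exprS fps_coefM big1 // => i _.
have [/F0->|led] := ltnP i d; first by rewrite mul0r.
by rewrite IHk ?mulr0 //; move: ltN (ltn_ord i); rewrite mulnS; lia.
Qed.

Lemma fps_coef_mulX0 d F G k N : (forall i, (i < d)%N -> F i = 0) ->
  (N < d * k)%N -> (G * F ^+ k) N = 0.
Proof.
move=> F0 ltN; rewrite fps_coefM big1 // => i _.
by rewrite (fps_expr_val F0) ?mulr0 // (leq_ltn_trans _ ltN) ?leq_subr.
Qed.

Lemma fps_coefMn F m N : (F *+ m) N = F N *+ m.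
Proof. by elim: m => // m IHm; rewrite !mulrS fps_coefD IHm. Qed.

Lemma eq_fps_expr F G k N : (forall i, (i <= N)%N -> F i = G i) ->
  (F ^+ k) N = (G ^+ k) N.
Proof.
elim: k N => // k IHk N eFG; rewrite !exprS !fps_coefM; apply: eq_bigr => i _.
by rewrite eFG ?IHk ?leq_ord // => j ?; apply: eFG; lia.
Qed.

End Deriv.

Section Exp.
Variable A : comAlgType rat.
Implicit Types F G Y : fps A.

(** Summing up to any common bound m makes it possible to exchange this sum with
    the one of a product of series. *)
Lemma fps_exp_coef F N m : F 0%N = 0 -> (N < m)%N ->
  fps_exp F N = \sum_(k < m) (k`!%:R^-1 : rat) *: (F ^+ k) N.
Proof.
move=> F0 ltNm; rewrite /fps_exp.
rewrite (big_ord_widen m (fun k => (k`!%:R^-1 : rat) *: (F ^+ k) N)) //.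
rewrite big_mkcond; apply: eq_bigr => k _; case: ltnP => // ltNk.
by rewrite fps_expr_ord ?scaler0.
Qed.

Lemma fps_exp_coef0 F : fps_exp F 0%N = 1.
Proof. by rewrite /fps_exp big_ord1 expr0 fps_coef1 fact0 invr1 scale1r. Qed.

Lemma eq_fps_exp F G N : (forall i, (i <= N)%N -> F i = G i) ->
  fps_exp F N = fps_exp G N.
Proof. by move=> eFG; apply: eq_bigr => k _; rewrite (eq_fps_expr k eFG). Qed.

Lemma scaler_fact k (a : A) :
  (k.+1`!%:R^-1 : rat) *: (a *+ k.+1) = (k`!%:R^-1 : rat) *: a.
Proof.
rewrite -scaler_nat scalerA factS natrM invfM mulrAC mulVf ?mul1r //.
by rewrite pnatr_eq0.
Qed.

Lemma fps_deriv_exp F : F 0%N = 0 ->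
  fps_deriv (fps_exp F) = fps_exp F * fps_deriv F.
Proof.
move=> F0; apply/funext=> N; rewrite [LHS]/fps_deriv.
rewrite (@fps_exp_coef _ _ N.+2) // -sumrMnl big_ord_recl.
rewrite expr0 fps_coef1 scaler0 mul0rn add0r fps_coefM.
under [RHS]eq_bigr => i _.
  rewrite (@fps_exp_coef _ i N.+1) // mulr_suml; under eq_bigr do rewrite -scalerAl.
  over.
rewrite exchange_big; apply: eq_bigr => k _ /=.
rewrite -scaler_sumr -(fps_coefM (F ^+ k) (fps_deriv F)) scalerMnr.
by rewrite -/(fps_deriv (F ^+ k.+1) N) fps_derivX fps_coefMn scaler_fact.
Qed.

Lemma mulrnI_rat (a b : A) N : a *+ N.+1 = b *+ N.+1 -> a = b.
Proof.
move/(congr1 (fun c => (N.+1%:R^-1 : rat) *: c)).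
by rewrite -!scaler_nat !scalerA mulVf ?scale1r // pnatr_eq0.
Qed.

(** In a Q-algebra the equation Y' = Y F' determines the coefficients of Y one
    after the other; the functional equation of exp below follows from it. *)
Lemma fps_exp_unique F Y : F 0%N = 0 -> Y 0%N = 1 ->
  fps_deriv Y = Y * fps_deriv F -> Y = fps_exp F.
Proof.
move=> F0 Y0 dY; apply/funext=> N.
elim/ltn_ind: N => -[_|N IHN]; first by rewrite Y0 fps_exp_coef0.
apply: (@mulrnI_rat _ _ N).
rewrite -/(fps_deriv Y N) -/(fps_deriv (fps_exp F) N) dY fps_deriv_exp //.
by rewrite !fps_coefM; apply: eq_bigr => i _; rewrite IHN.
Qed.

Lemma fps_expD F G : F 0%N = 0 -> G 0%N = 0 ->
  fps_exp (F + G) = fps_exp F * fps_exp G.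
Proof.
move=> F0 G0; apply/esym/fps_exp_unique.
- by rewrite fps_coefD F0 G0 addr0.
- by rewrite fps_coefM big_ord1 !fps_exp_coef0 mulr1.
rewrite fps_derivM !fps_deriv_exp //.
have -> : fps_deriv (F + G) = fps_deriv F + fps_deriv G.
  by apply/funext=> N; rewrite fps_coefD /fps_deriv fps_coefD mulrnDl.
by rewrite mulrDr mulrAC mulrA.
Qed.

Lemma fps_exp_sum I (r : seq I) (F : I -> fps A) :
  (forall i, F i 0%N = 0) ->
  \prod_(i <- r) fps_exp (F i) = fps_exp (\sum_(i <- r) F i).
Proof.
move=> F0.
suff [_ //] : (\sum_(i <- r) F i) 0%N = 0 /\
    \prod_(i <- r) fps_exp (F i) = fps_exp (\sum_(i <- r) F i).
elim: r => [|i r [IH0 IH]].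
  rewrite !big_nil; split=> //; apply: fps_exp_unique => //.
  by apply/funext=> N; rewrite fps_coefM big1 /fps_deriv ?mul0rn // => i _;
    rewrite mul0rn mulr0.
by rewrite !big_cons fps_coefD F0 IH0 addr0 IH fps_expD.
Qed.

Lemma fps_exp_t N : fps_exp (fps_t : fps A) N = (N`!%:R^-1 : rat) *: 1.
Proof.
rewrite /fps_exp (bigD1 ord_max) //= fps_coef_tX eqxx big1 ?addr0 // => k.
rewrite -val_eqE /= fps_coef_tX eq_sym => /negPf->; exact: scaler0.
Qed.

End Exp.

Lemma fps_exprZ (A : comNzRingType) (c : A) (F : fps A) k N :
  ((c *: F) ^+ k) N = c ^+ k * (F ^+ k) N.
Proof.
elim: k N => [|k IHk] N; first by rewrite !expr0 mul1r.
rewrite !exprS !fps_coefM mulr_sumr; apply: eq_bigr => i _.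
by rewrite fps_coefZ IHk mulrACA.
Qed.

Lemma fps_expM_exp (A : comAlgType rat) (E F : fps A) (c : A) N : F 0%N = 0 ->
  (E * fps_exp (c *: F)) N =
  \sum_(0 <= k < N.+1) (k`!%:R^-1 : rat) *: ((E * F ^+ k) N * c ^+ k).
Proof.
move=> F0; rewrite big_mkord fps_coefM.
under eq_bigr => i _.
  rewrite (@fps_exp_coef _ _ (N - i) N.+1); [|by rewrite fps_coefZ F0 mulr0|by lia].
  rewrite mulr_sumr; over.
rewrite exchange_big; apply: eq_bigr => k _ /=.
rewrite fps_coefM mulr_suml scaler_sumr; apply: eq_bigr => i _.
by rewrite fps_exprZ -scalerAr mulrCA mulrC.
Qed.

(** * Laminar families of sets and their blocks *)

Section Laminar.
Local Open Scope nat_scope.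
Variable T : finType.
Implicit Types (S : {set {set T}}) (A B X : {set T}) (x i j : T).

Definition laminar S : bool :=
  [forall A in S, forall B in S,
    [|| [disjoint A & B], A \subset B | B \subset A]].

(** For a laminar S this is the largest member of S containing i, or the
    singleton of i when there is none ([block_mem], [block_uncovered]); the
    blocks of the points of X are thus the trees of the forest. *)
Definition block S i : {set T} := i |: \bigcup_(B in S | i \in B) B.

Definition below S A : {set {set T}} := [set B in S | B \proper A].

Definition laminar_on X S : bool :=
  laminar S && [forall A in S, (A \subset X) && (1 < #|A|)].

Lemma laminar_meet S A B i : laminar S -> A \in S -> B \in S ->
  i \in A -> i \in B -> (A \subset B) || (B \subset A).
Proof.
move=> /forall_inP lS AS BS iA iB.
have /forall_inP/(_ B BS)/orP[dAB|//] := lS A AS.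
by rewrite (disjointFr dAB iA) in iB.
Qed.

Lemma sub_laminar S S' : S' \subset S -> laminar S -> laminar S'.
Proof.
move=> /subsetP sS' /forall_inP lS; apply/forall_inP=> A /sS' AS.
apply/forall_inP=> B /sS' BS; by have /forall_inP/(_ B BS) := lS A AS.
Qed.

Lemma in_block S i j :
  (j \in block S i) = (j == i) || [exists B in S, (i \in B) && (j \in B)].
Proof.
rewrite in_setU1; congr (_ || _); apply/bigcupP/exists_inP.
  by case=> B /andP[BS iB] jB; exists B; rewrite // iB.
by case=> B BS /andP[iB jB]; exists B; rewrite // BS.
Qed.

Lemma block_self S i : i \in block S i.
Proof. by rewrite in_block eqxx. Qed.

Lemma sub_block S B i : B \in S -> i \in B -> B \subset block S i.
Proof.
move=> BS iB; apply/subsetP=> j jB; rewrite in_block; apply/orP; right.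
by apply/exists_inP; exists B; rewrite // iB.
Qed.

Lemma eq_block S S' i :
  (forall B, i \in B -> (B \in S) = (B \in S')) -> block S i = block S' i.
Proof.
move=> eSS'; congr (_ |: _); apply: eq_bigl => B.
by have [/eSS'->|] := boolP (i \in B); rewrite ?andbF.
Qed.

(** The relation of lying in a common member is transitive because two members
    which meet are comparable; so the blocks partition the points. *)
Lemma block_eq S i j : laminar S -> j \in block S i -> block S j = block S i.
Proof.
move=> lS.
have sub a b : b \in block S a -> block S b \subset block S a.
  rewrite in_block => /orP[/eqP->//|/exists_inP[B BS /andP[aB bB]]].
  apply/subsetP=> c; rewrite in_block => /orP[/eqP->|].
    exact: (subsetP (sub_block BS aB)).
  case/exists_inP=> C CS /andP[bC cC].
  have /orP[/subsetP sBC|/subsetP sCB] := laminar_meet lS BS CS bB bC.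
    by apply: (subsetP (sub_block CS _)) => //; apply: sBC.
  by apply: (subsetP (sub_block BS aB)); apply: sCB.
move=> ji; apply/eqP; rewrite eqEsubset !sub //.
move: ji; rewrite !in_block => /orP[/eqP->|/exists_inP[B BS iBj]].
  by rewrite eqxx.
by apply/orP; right; apply/exists_inP; exists B; rewrite // andbC.
Qed.

(** Among the members containing x, one of maximal size contains the others. *)
Lemma block_mem S x : laminar S -> x \in cover S -> block S x \in S.
Proof.
move=> lS /bigcupP[A0 A0S xA0].
have PA0 : (A0 \in S) && (x \in A0) by rewrite A0S.
case: (@arg_maxnP _ A0 (fun A => (A \in S) && (x \in A)) (fun A => #|A|) PA0)
  => A /andP[AS xA] maxA.
suff -> : block S x = A by [].
apply/eqP; rewrite eqEsubset sub_block // andbT subUset sub1set xA.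
apply/bigcupsP=> B /andP[BS xB].
have /orP[//|sAB] := laminar_meet lS BS AS xB xA.
have /eqP-> // : A == B.
by rewrite eqEcard sAB; apply: maxA; rewrite BS.
Qed.

Lemma sub_cover_block S B i j :
  laminar S -> B \in S -> j \in B -> j \in block S i -> B \subset block S i.
Proof. by move=> lS BS jB /(block_eq lS) <-; apply: sub_block. Qed.

Lemma block_sub X S i :
  laminar_on X S -> i \in X -> block S i \subset X.
Proof.
move=> /andP[_ /forall_inP sX] iX; rewrite subUset sub1set iX.
by apply/bigcupsP=> B /andP[/sX/andP[]].
Qed.

Lemma laminar_onW X S : laminar_on X S -> laminar S.
Proof. by case/andP. Qed.

Lemma laminar_on_sub X S S' : S' \subset S -> laminar_on X S -> laminar_on X S'.
Proof.
move=> sS' /andP[lS /forall_inP sX]; rewrite /laminar_on (sub_laminar sS') //=.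
by apply/forall_inP=> A /(subsetP sS')/sX.
Qed.

Lemma laminar_on_D1 X S x :
  laminar_on (X :\ x) S = laminar_on X S && (x \notin cover S).
Proof.
rewrite /laminar_on -andbA; congr (_ && _).
apply/forall_inP/andP => [H|[/forall_inP H xS] A AS].
  split; first by apply/forall_inP=> A /H; rewrite subsetD1 => /andP[/andP[-> _] ->].
  by apply/bigcupP => -[A /H]; rewrite subsetD1 => /andP[/andP[_ /negP]].
rewrite subsetD1; have /andP[-> ->] := H A AS; rewrite andbT; apply: contra xS => xA.
by apply/bigcupP; exists A.
Qed.

Lemma block_uncovered S x : x \notin cover S -> block S x = [set x].
Proof.
move=> xS; rewrite /block big1 ?setU0 // => B /andP[BS xB].
by case/bigcupP: xS; exists B.
Qed.

Lemma card_blocks_D1 X S x : x \in X -> x \notin cover S ->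
  #|block S @: X| = #|block S @: (X :\ x)|.+1.
Proof.
move=> xX xS; rewrite -{1}(setD1K xX) imsetU1 cardsU1 (block_uncovered xS).
suff -> : [set x] \notin block S @: (X :\ x) by [].
apply/imsetP=> -[i iX e].
have : i \in [set x] by rewrite e block_self.
by move: iX; rewrite !inE => /andP[/negPf->].
Qed.

(** Joining under a new root the trees of a set J, one of which contains x; the
    new member is [cover J]. *)
Section Merge.
Variables (X : {set T}) (S : {set {set T}}) (J : {set {set T}}) (x : T).
Hypotheses (lS : laminar_on X S) (xX : x \in X) (sJ : J \subset block S @: X).
Hypotheses (xJ : block S x \in J) (J1 : 1 < #|J|).

Lemma mem_cover_block i : (i \in cover J) = (block S i \in J).
Proof.
apply/bigcupP/idP => [[b bJ ib]|bJ]; last by exists (block S i); rewrite ?block_self.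
have /imsetP[j _ eb] := subsetP sJ b bJ.
by rewrite eb in ib bJ; rewrite (block_eq (laminar_onW lS) ib).
Qed.

Lemma merge_blocks : block S @: cover J = J.
Proof.
apply/setP=> b; apply/imsetP/idP => [[i iJ ->]|bJ]; first by rewrite -mem_cover_block.
have /imsetP[j _ eb] := subsetP sJ b bJ.
by exists j; rewrite // mem_cover_block -eb.
Qed.

Lemma sub_merge B i : B \in S -> i \in B -> i \in cover J -> B \subset cover J.
Proof.
move=> BS iB; rewrite mem_cover_block => bJ.
exact: subset_trans (sub_block BS iB) (bigcup_sup _ bJ).
Qed.

Lemma merge_two : exists2 y, y \in cover J & block S y != block S x.
Proof.
have : 0 < #|J :\ block S x| by have := J1; rewrite (cardsD1 (block S x)) xJ add1n.
rewrite card_gt0 => /set0Pn[b]; rewrite !inE => /andP[nb bJ].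
have /imsetP[y _ eb] := subsetP sJ b bJ.
by exists y; rewrite ?mem_cover_block -?eb.
Qed.

(** A member equal to [cover J] would be a single block, while J has two. *)
Lemma merge_notin : cover J \notin S.
Proof.
apply/negP=> AS; have [y yJ] := merge_two.
have xA : x \in cover J by rewrite mem_cover_block.
rewrite (@block_eq S x y) ?eqxx ?(laminar_onW lS) //.
exact: subsetP (sub_block AS xA) _ yJ.
Qed.

Lemma merge_laminar : laminar_on X (cover J |: S).
Proof.
have nest B : B \in S -> [disjoint B & cover J] || (B \subset cover J).
  move=> BS; have [//|/pred0Pn[i /andP[iB iJ]]] := boolP [disjoint _ & _].
  exact: sub_merge iJ.
have /andP[/forall_inP lS' /forall_inP sX] := lS.
apply/andP; split.
  apply/forall_inP=> A AS; apply/forall_inP=> B BS.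
  case/setU1P: AS => [->|AS]; case/setU1P: BS => [->|BS].
  - by rewrite subxx !orbT.
  - by rewrite disjoint_sym; have /orP[->|->] := nest B BS; rewrite ?orbT.
  - by have /orP[->|->] := nest A AS; rewrite ?orbT.
  - by have /forall_inP/(_ B BS) := lS' A AS.
apply/forall_inP=> A /setU1P[->|/sX//]; apply/andP; split.
  apply/bigcupsP=> b /(subsetP sJ)/imsetP[i iX ->]; exact: block_sub.
have [y yJ nyx] := merge_two.
rewrite (cardsD1 x) mem_cover_block xJ add1n ltnS card_gt0; apply/set0Pn; exists y.
by rewrite !inE yJ andbT; apply: contraNneq nyx => ->.
Qed.

Lemma block_merge i :
  block (cover J |: S) i = if i \in cover J then cover J else block S i.
Proof.
case: ifP => iJ; last first.
  apply: eq_block => B iB; rewrite in_setU1; case: eqP => // eB.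
  by rewrite eB iJ in iB.
apply/eqP; rewrite eqEsubset sub_block ?setU11 // andbT subUset sub1set iJ.
apply/bigcupsP=> B /andP[/setU1P[->//|BS] iB]; exact: sub_merge iJ.
Qed.

(** The new tree replaces the trees of J; it is not one of the old ones, which do
    not contain two trees of J. *)
Lemma card_merge_blocks :
  #|block (cover J |: S) @: X| = (#|block S @: X| - #|J|).+1.
Proof.
have -> : block (cover J |: S) @: X = cover J |: (block S @: X :\: J).
  apply/setP=> b; rewrite !inE; apply/imsetP/orP => [[i iX ->]|].
    rewrite block_merge; have [|iJ] := ifPn; first by left; rewrite eqxx.
    by right; rewrite -mem_cover_block iJ imset_f.
  case=> [/eqP->|/andP[bJ /imsetP[i iX eb]]].
    by exists x; rewrite // block_merge mem_cover_block xJ.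
  by exists i; rewrite // block_merge mem_cover_block -eb (negPf bJ).
rewrite cardsU1 cardsD (setIidPr sJ) !inE.
suff -> : cover J \in block S @: X = false by rewrite andbF.
apply/imsetP=> -[i _ e].
have [y yJ] := merge_two.
have xA : x \in cover J by rewrite mem_cover_block.
have lS' := laminar_onW lS.
rewrite e in yJ xA.
by rewrite (block_eq lS' yJ) (block_eq lS' xA) eqxx.
Qed.

Lemma below_merge_top : block (below (cover J |: S) (cover J)) @: cover J = J.
Proof.
rewrite -[RHS]merge_blocks; apply: eq_in_imset => i iJ.
apply: eq_block => B iB; rewrite !inE properEneq.
case: eqP => [->|_] /=; first by rewrite (negPf merge_notin).
by apply: andb_idr => BS; apply: sub_merge iJ.
Qed.

Lemma below_merge B : B \in S -> below (cover J |: S) B = below S B.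
Proof.
move=> BS; apply/setP=> C; rewrite !inE; case: eqP => //= -> .
have [sAB|] := boolP (cover J \proper B); rewrite ?andbF //.
have xA : x \in cover J by rewrite mem_cover_block.
case/properP: sAB => [/subsetP/(_ x xA) xB [y yB]].
by rewrite (subsetP (sub_merge BS xB xA)).
Qed.

End Merge.

(** The inverse operation: removing the root of the tree containing x, and
    remembering the trees that it joined. *)
Section Split.
Variables (X : {set T}) (S : {set {set T}}) (x : T).
Hypotheses (lS : laminar_on X S) (xX : x \in X) (xS : x \in cover S).
Let A := block S x.
Let S' := S :\ A.
Let J := block S' @: A.

Lemma split_laminar : laminar_on X S'.
Proof. by apply: laminar_on_sub lS; apply: subsetDl. Qed.

Lemma split_cover : cover J = A.
Proof.
apply/eqP; rewrite eqEsubset; apply/andP; split.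
  apply/bigcupsP=> _ /imsetP[i iA ->]; rewrite subUset sub1set iA.
  apply/bigcupsP=> B /andP[]; rewrite !inE => /andP[_ BS] iB.
  exact: sub_cover_block (laminar_onW lS) BS iB iA.
by apply/subsetP=> i iA; apply/bigcupP; exists (block S' i);
  rewrite ?imset_f ?block_self.
Qed.

Lemma split_sub : J \subset block S' @: X.
Proof. by apply: imsetS; apply: block_sub. Qed.

Lemma split_mem : block S' x \in J.
Proof. by rewrite imset_f ?block_self. Qed.

(** If the removed root A had a single child, this child would be A itself, as
    A is covered by its children; but a block with two points is a member. *)
Lemma split_card : 1 < #|J|.
Proof.
rewrite (cardsD1 (block S' x)) split_mem add1n ltnS card_gt0.
apply/eqP=> J0.
have eJ : J = [set block S' x] by rewrite -(setD1K split_mem) J0 setU0.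
have eA : A = block S' x by rewrite -split_cover eJ /cover big_set1.
have AS : A \in S by rewrite block_mem ?(laminar_onW lS).
have /andP[_ /forall_inP/(_ A AS)/andP[_ A1]] := lS.
have [xS'|/block_uncovered eb] := boolP (x \in cover S'); last first.
  by rewrite eA eb cards1 in A1.
have := block_mem (laminar_onW split_laminar) xS'.
by rewrite -eA !inE eqxx.
Qed.
End Split.

End Laminar.

(** * Weighted enumeration of forests *)

Section Enumeration.
Variables (A : comAlgType rat) (w : nat -> A).
Hypotheses (w0 : w 0%N = 0) (w1 : w 1%N = 0).
Variable T : finType.
Implicit Types (S : {set {set T}}) (X : {set T}) (G : fps A).

(** The blocks of the members strictly inside B are the children of B. *)
Definition arity S B := #|block (below S B) @: B|.
Definition weight S : A := \prod_(B in S) w (arity S B).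
(** Coefficients with respect to the basis t^r/r!, in which the product and the
    derivative are those of exponential generating functions. *)
Definition hcoef G r : A := G r *+ r`!.
Definition egf : fps A := fun i => (i`!%:R^-1 : rat) *: w i.

(** The sum Phi_{n,k}(G): G records the number of trees, shifted by
    one so that removing a tree on one point is the derivation of G. *)
Definition nested_sum X k G : A :=
  \sum_(S : {set {set T}} | laminar_on X S && (#|S| == k))
    weight S * hcoef G (#|block S @: X|).-1.

Lemma sum_subsets (U : finType) (B : {set U}) (f : nat -> A) :
  \sum_(J : {set U} | J \subset B) f #|J| =
  \sum_(j < #|B|.+1) f j *+ 'C(#|B|, j).
Proof.
pose p (J : {set U}) : 'I_#|B|.+1 := inord #|J|.
rewrite (partition_big p xpredT) //=; apply: eq_bigr => j _.
rewrite -cards_draws -sumr_const; apply: eq_big => [J|J /andP[sJB /eqP <-]].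
  rewrite inE; case sJB: (J \subset B) => //=.
  by rewrite -val_eqE /= inordK // ltnS subset_leq_card.
by rewrite inordK // ltnS subset_leq_card.
Qed.

Lemma sum_subsets_at (U : finType) (B : {set U}) b (f : nat -> A) : b \in B ->
  \sum_(J : {set U} | (J \subset B) && (b \in J)) f #|J| =
  \sum_(j < #|B|) f j.+1 *+ 'C(#|B|.-1, j).
Proof.
move=> bB; have cB : #|B| = #|B :\ b|.+1 by rewrite (cardsD1 b) bB.
rewrite cB /= -(sum_subsets _ (fun j => f j.+1)).
rewrite (reindex_onto (fun J => b |: J) (fun J => J :\ b)) /=; last first.
  by move=> J /andP[_ bJ]; rewrite setD1K.
apply: eq_big => [J|J].
  rewrite setU11 andbT subUset sub1set bB /= subsetD1.
  case bJ: (b \in J); last by rewrite setU1K ?bJ // eqxx !andbT.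
  rewrite !andbF; apply/negbTE; rewrite negb_and; apply/orP; right.
  by apply/eqP=> e; move: bJ; rewrite -e !inE eqxx.
by move=> /andP[_ /eqP e]; rewrite cardsU1 -e !inE eqxx.
Qed.

Lemma hcoef_deriv G r : hcoef (fps_deriv G) r = hcoef G r.+1.
Proof. by rewrite /hcoef /fps_deriv -mulrnA factS. Qed.

Lemma egf_deriv j : hcoef (fps_deriv egf) j = w j.+1.
Proof.
rewrite hcoef_deriv /hcoef /egf -scaler_nat scalerA mulfV ?scale1r //.
by rewrite pnatr_eq0 -lt0n fact_gt0.
Qed.

Lemma hcoefM F G r :
  hcoef (F * G) r = \sum_(j < r.+1) (hcoef F j * hcoef G (r - j)%N) *+ 'C(r, j).
Proof.
rewrite /hcoef fps_coefM -sumrMnl; apply: eq_bigr => j _.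
rewrite mulrnAl mulrnAr -!mulrnA.
by rewrite -(bin_fact (leq_ord j)); congr (_ *+ _); lia.
Qed.

(** Choosing j further trees, besides the one of x, among the other |B| - 1 is
    the binomial convolution of phi' with G.  The sets J with one element may
    be added to the sum since w_1 = 0. *)
Lemma sum_merge S X x G : laminar_on X S -> x \in X ->
  let B := block S @: X in
  \sum_(J : {set {set T}} | [&& J \subset B, block S x \in J & (1 < #|J|)%N])
    w #|J| * hcoef G (#|B| - #|J|)%N
  = hcoef (G * fps_deriv egf) #|B|.-1.
Proof.
move=> lS xX B; have bB : block S x \in B by apply: imset_f.
transitivity (\sum_(J : {set {set T}} | (J \subset B) && (block S x \in J))
    w #|J| * hcoef G (#|B| - #|J|)%N).
  rewrite [RHS](bigID (fun J : {set {set T}} => (1 < #|J|)%N)) /=.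
  rewrite [X in _ + X]big1 ?addr0; first by apply: eq_bigl => J; rewrite -andbA.
  move=> J /andP[_]; rewrite -leqNgt; case: #|J| => [|[|//]] _.
    by rewrite w0 mul0r.
  by rewrite w1 mul0r.
rewrite (sum_subsets_at (fun j => w j * hcoef G (#|B| - j)%N) bB).
have : (0 < #|B|)%N by rewrite (cardsD1 (block S x)) bB.
rewrite mulrC hcoefM; case: #|B| => // r _ /=; apply: eq_bigr => j _.
by rewrite egf_deriv subSS.
Qed.

Lemma weight_merge X S (J : {set {set T}}) x : laminar_on X S -> x \in X ->
  J \subset block S @: X -> block S x \in J -> (1 < #|J|)%N ->
  weight (cover J |: S) = w #|J| * weight S.
Proof.
move=> lS xX sJ xJ J1; rewrite /weight big_setU1 ?(merge_notin lS sJ xJ J1) //=.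
rewrite {1}/arity (below_merge_top lS sJ xJ J1); congr (_ * _).
by apply: eq_bigr => B BS; rewrite /arity (below_merge lS sJ xJ).
Qed.

(** Removing the root of the tree of x is a bijection onto the pairs of a forest
    and a set of at least two of its trees including the one of x. *)
Lemma sum_covered X x k G : x \in X ->
  \sum_(S : {set {set T}} | [&& laminar_on X S, #|S| == k.+1 & x \in cover S])
    weight S * hcoef G (#|block S @: X|).-1
  = nested_sum X k (G * fps_deriv egf).
Proof.
move=> xX; pose h (p : {set {set T}} * {set {set T}}) := cover p.2 |: p.1.
pose h' S := (S :\ block S x, block (S :\ block S x) @: block S x).
rewrite (reindex_onto h h') /=; last first.
  move=> S /and3P[lS _ xS]; rewrite /h /h' /= (split_cover _ lS) //.
  by rewrite setD1K // block_mem ?(laminar_onW lS).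
transitivity (\sum_(p : {set {set T}} * {set {set T}} |
     (laminar_on X p.1 && (#|p.1| == k)) &&
     [&& p.2 \subset block p.1 @: X, block p.1 x \in p.2 & (1 < #|p.2|)%N])
   weight p.1 * (w #|p.2| * hcoef G (#|block p.1 @: X| - #|p.2|)%N)).
  under eq_bigl => p.
    rewrite (_ : _ && _ = (laminar_on X p.1 && (#|p.1| == k)) &&
     [&& p.2 \subset block p.1 @: X, block p.1 x \in p.2 & (1 < #|p.2|)%N]); first over.
    (* The first condition recovers (S, J) from the new family by [h'], hence
       gives the properties of J; conversely they make [h'] undo [h]. *)
    case: p => S J /=; apply/andP/andP => [[/and3P[lS cS xS] /eqP[eS eJ]]|[/andP[lS cS] /and3P[sJ xJ J1]]].
      move: lS cS xS eS eJ; set S1 := h (S, J) => lS cS xS eS eJ.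
      have AS : block S1 x \in S1 by rewrite block_mem ?(laminar_onW lS).
      rewrite -eJ -eS; split; last first.
        by rewrite (split_sub lS xX) split_mem (split_card lS xS).
      rewrite (split_laminar _ lS) //=.
      by move: cS; rewrite (cardsD1 (block S1 x)) AS add1n eqSS.
    rewrite /h /= (merge_laminar lS sJ xJ J1).
    rewrite cardsU1 (merge_notin lS sJ xJ J1) add1n eqSS cS /=.
    have xA : x \in cover J by rewrite (mem_cover_block lS sJ).
    split.
      by apply/bigcupP; exists (cover J); rewrite ?setU11.
    rewrite /h' (block_merge lS sJ) xA setU1K ?(merge_notin lS sJ xJ J1) //.
    by rewrite (merge_blocks lS sJ).
  apply: eq_bigr => -[S J] /= /andP[/andP[lS _] /and3P[sJ xJ J1]].
  rewrite /h /= (weight_merge lS xX sJ xJ J1) (card_merge_blocks lS xX sJ xJ J1).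
  by rewrite /= mulrCA mulrA.
transitivity (\sum_(S : {set {set T}} | laminar_on X S && (#|S| == k))
    \sum_(J : {set {set T}} |
        [&& J \subset block S @: X, block S x \in J & (1 < #|J|)%N])
      weight S * (w #|J| * hcoef G (#|block S @: X| - #|J|)%N)).
  by rewrite pair_big_dep.
apply: eq_bigr => S /andP[lS _]; rewrite -big_distrr /=; congr (_ * _).
exact: sum_merge.
Qed.

(** If x is a tree on its own, the same family is a forest on X minus x.  As it is
    not empty, that forest has a tree, so the predecessors taken on the numbers
    of trees are not truncated. *)
Lemma sum_uncovered X x k G : x \in X ->
  \sum_(S : {set {set T}} | [&& laminar_on X S, #|S| == k.+1 & x \notin cover S])
    weight S * hcoef G (#|block S @: X|).-1
  = nested_sum (X :\ x) k.+1 (fps_deriv G).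
Proof.
move=> xX; apply: eq_big => [S|S /and3P[lS cS xS]].
  by rewrite laminar_on_D1 -andbA; congr (_ && _); rewrite andbC.
rewrite (card_blocks_D1 xX xS) hcoef_deriv /=; congr (_ * hcoef _ _).
apply/esym/prednK; rewrite card_gt0 imset_eq0; apply/set0Pn.
have : (0 < #|S|)%N by rewrite (eqP cS).
rewrite card_gt0 => /set0Pn[B BS].
have /andP[_ /forall_inP/(_ B BS)/andP[sBX B1]] := lS.
have /set0Pn[y yB] : B != set0 by rewrite -card_gt0 ltnW.
exists y; rewrite !inE (subsetP sBX) // andbT; apply: contraNneq xS => <-.
by apply/bigcupP; exists B.
Qed.

Lemma nested_sumS X x k G : x \in X ->
  nested_sum X k.+1 G =
  nested_sum (X :\ x) k.+1 (fps_deriv G) + nested_sum X k (G * fps_deriv egf).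
Proof.
move=> xX; rewrite -(sum_covered _ _ xX) -(sum_uncovered _ _ xX) [RHS]addrC.
rewrite /nested_sum (bigID (fun S => x \in cover S)) /=.
by congr (_ + _); apply: eq_bigl => S; rewrite -andbA.
Qed.

(** The empty family is the forest of |X| trees on one point. *)
Lemma nested_sum0 X G : nested_sum X 0 G = hcoef G #|X|.-1.
Proof.
rewrite /nested_sum (big_pred1 set0) => [|S]; last first.
  rewrite cards_eq0 /=; case: eqP => [->|]; rewrite ?andbF // andbT.
  by apply/andP; split; apply/forall_inP=> A0; rewrite inE.
rewrite /weight big_set0 mul1r card_imset // => i j.
rewrite !block_uncovered ?/cover ?big_set0 ?inE // => e.
by apply/set1P; rewrite -e set11.
Qed.

Lemma nested_sum_set0 k G : nested_sum set0 k.+1 G = 0.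
Proof.
rewrite /nested_sum big_pred0 // => S; apply/negbTE/andP=> -[/andP[_ lS] cS].
have : (0 < #|S|)%N by rewrite (eqP cS).
rewrite card_gt0 => /set0Pn[B BS].
have /forall_inP/(_ B BS)/andP[] := lS.
by rewrite subset0 => /eqP->; rewrite cards0.
Qed.

Lemma egf_val i : (i < 2)%N -> egf i = 0.
Proof. by case: i => [|[|//]] _; rewrite /egf ?w0 ?w1 scaler0. Qed.

(** Both sides satisfy the same recursion, [nested_sumS] and the Leibniz rule.
    Allowing X to be empty when k > 0 makes the recursion stop there: both
    sides vanish, the right one because phi^k starts at t^(2k). *)
Lemma nested_sumE X k N G : (#|X| + k = N.+1)%N ->
  nested_sum X k G *+ k`! = hcoef (G * egf ^+ k) N.
Proof.
elim: k X N G => [|k IHk] X N G.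
  by rewrite addn0 nested_sum0 expr0 mulr1 mulr1n => ->.
move: {-1}#|X| (erefl #|X|) => n; elim: n X N G => [|n IHn] X N G cX.
  rewrite add0n => -[<-]; move/eqP: cX; rewrite cards_eq0 => /eqP->.
  rewrite nested_sum_set0 mul0rn /hcoef (fps_coef_mulX0 _ egf_val) ?mul0rn //.
  by rewrite mul2n -addnn ltn_addr.
case: N => [|N] eN; first by move: eN; lia.
have /set0Pn[x xX] : X != set0 by rewrite -card_gt0 cX.
have cXx : #|X :\ x| = n by move: cX; rewrite (cardsD1 x) xX => -[].
rewrite (nested_sumS _ _ xX) mulrnDl (IHn _ N) //; last by move: eN; lia.
rewrite factS mulnC mulrnA (IHk _ N) //; last by rewrite cX; move: eN; lia.
rewrite -hcoef_deriv fps_derivM fps_derivX /hcoef fps_coefD mulrnDl.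
congr (_ + _); rewrite mulrnAC -(fps_coefMn (_ * egf ^+ k)).
by rewrite -mulrA [_ * egf ^+ k]mulrC mulrnAr.
Qed.

(** All the [hcoef] of e^t are 1, so this choice of G forgets the number of
    trees. *)
Lemma nested_sum_exp X k N : (#|X| + k = N.+1)%N ->
  (N`!%:R^-1 : rat) *:
    (\sum_(S : {set {set T}} | laminar_on X S && (#|S| == k)) weight S)
  = (k`!%:R^-1 : rat) *: (fps_exp fps_t * egf ^+ k) N.
Proof.
move=> eN; have nz m : m`!%:R != 0 :> rat by rewrite pnatr_eq0 -lt0n fact_gt0.
have <- : nested_sum X k (fps_exp fps_t) =
    \sum_(S : {set {set T}} | laminar_on X S && (#|S| == k)) weight S.
  apply: eq_bigr => S _.
  by rewrite /hcoef fps_exp_t -scaler_nat scalerA divff // scale1r mulr1.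
have := nested_sumE (fps_exp fps_t) eN; rewrite /hcoef -!scaler_nat => e.
apply: (scalerI (nz k)); rewrite scalerA mulrC -scalerA e.
by rewrite !scalerA divff // mulVf.
Qed.

End Enumeration.

(** * Dimensions of sums of irreducible subspaces *)

Section Representative.
Variable T : finType.
Implicit Types (S : {set {set T}}) (A : {set T}) (i j : T).

(** As the blocks of a laminar family partition the points, this chooses the same
    point for all the points of a block. *)
Definition block_rep S i : T := odflt i [pick j in block S i].

Lemma block_rep_in S i : block_rep S i \in block S i.
Proof. by rewrite /block_rep; case: pickP => //= _; apply: block_self. Qed.

Lemma block_repE S i j : block S i = block S j -> block_rep S i = block_rep S j.
Proof.
move=> e; rewrite /block_rep e; case: pickP => //= /(_ j).
by rewrite block_self.
Qed.

Lemma block_block_rep S i : laminar S -> block S (block_rep S i) = block S i.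
Proof. by move=> lS; apply/block_eq/block_rep_in. Qed.

Lemma block_rep_idem S i : laminar S ->
  block_rep S (block_rep S i) = block_rep S i.
Proof. by move=> lS; apply/block_repE/block_block_rep. Qed.

(** A point is its own representative once in each block. *)
Lemma card_block_rep S A : laminar_on A S ->
  (#|[set i | block_rep S i != i]| + #|block S @: A| = #|A|)%N.
Proof.
move=> lSA; have lS := laminar_onW lSA.
have sA : [set i | block_rep S i != i] \subset A.
  apply/subsetP=> i; rewrite inE; apply: contraR => iA.
  have : block_rep S i \in block S i by apply: block_rep_in.
  rewrite block_uncovered ?inE //; apply: contra iA => /bigcupP[B BS].
  by have /andP[_ /forall_inP/(_ B BS)/andP[/subsetP sBA _]] := lSA; apply: sBA.
rewrite -(cardsID [set i | block_rep S i != i] A) (setIidPr sA); congr (_ + _)%N.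
have -> : block S @: A = block S @: (A :\: [set i | block_rep S i != i]).
  apply/setP=> b; apply/imsetP/imsetP => [[i iA ->]|[i iA ->]]; last first.
    by move: iA; rewrite inE => /andP[_ iA]; exists i.
  exists (block_rep S i); last by rewrite block_block_rep.
  rewrite !inE block_rep_idem // eqxx /=.
  exact: (subsetP (block_sub lSA iA) _ (block_rep_in S i)).
rewrite card_in_imset // => i j.
rewrite !inE !negbK => /andP[/eqP ri _] /andP[/eqP rj _] /block_repE.
by rewrite ri rj.
Qed.

End Representative.

Section Dimension.
Variables (R : realType) (n : nat).
Implicit Types (A B : irr n) (S Q : {set irr n}).
Local Notation e i := (delta_mx 0 i : 'rV[R[i]]_n).

Lemma mem_irr_space A i j : i \in val A -> j \in val A ->
  e i - e j \in irr_space R A.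
Proof.
by move=> iA jA; apply/memv_span/allpairsP; exists (i, j); rewrite !mem_enum.
Qed.

Lemma irr_space_sub A (U : {vspace 'rV[R[i]]_n}) :
  (forall i j, i \in val A -> j \in val A -> e i - e j \in U) ->
  (irr_space R A <= U)%VS.
Proof.
move=> sAU; apply/span_subvP=> v /allpairsP[[i j] /= [iA jA ->]].
by rewrite !mem_enum in iA jA; apply: sAU.
Qed.

(** A point i outside A is detected by the coordinate i, which vanishes on the
    subspace of A. *)
Lemma irr_space_mono A B :
  (irr_space R B <= irr_space R A)%VS = (val B \subset val A).
Proof.
apply/idP/subsetP => [sBA i iB|sBA]; last first.
  by apply: irr_space_sub => i j iB jB; apply: mem_irr_space; apply: sBA.
have [j jB neq_ji] : exists2 j, j \in val B & j != i.
  have := valP B; rewrite (cardsD1 i) iB ltnS card_gt0 => /set0Pn[j].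
  by rewrite !inE => /andP[ne_ji jB]; exists j.
apply: contraT => iA; pose f : 'Hom('rV[R[i]]_n, 'cV[R[i]]_1) := linfun (col i).
have fE k : f (e k) = ((i == k)%:R)%:M.
  by rewrite lfunE; apply/matrixP=> a b; rewrite !mxE !ord1.
have kerA : (irr_space R A <= lker f)%VS.
  apply: irr_space_sub => a b aA bA; rewrite memv_ker linearB /= !fE.
  have ne c : c \in val A -> (i == c) = false.
    by move=> cA; apply: contraNF iA => /eqP->.
  by rewrite !ne // subrr.
have := subvP (subv_trans sBA kerA) _ (mem_irr_space iB jB).
rewrite memv_ker linearB /= !fE eqxx [i == j]eq_sym (negPf neq_ji) raddf0 subr0.
by move/eqP/matrixP/(_ 0 0); rewrite !mxE => /eqP; rewrite oner_eq0.
Qed.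

(** The vectors e_i - e_(r i) with r i <> i are free: the coordinate i sees only
    one of them, as the values of r are fixed points. *)
Lemma dim_idempotent (r : 'I_n -> 'I_n) (U : {vspace 'rV[R[i]]_n}) :
  (forall i, r (r i) = r i) -> (forall i, e i - e (r i) \in U) ->
  (forall V : {vspace 'rV[R[i]]_n}, (forall i, e i - e (r i) \in V) -> (U <= V)%VS) ->
  \dim U = #|[set i | r i != i]|.
Proof.
move=> rr memU minU; pose F := [set i | r i != i].
pose X := [tuple e (enum_val k) - e (r (enum_val k)) | k < #|F|].
have -> : U = <<X>>%VS.
  apply/eqP; rewrite eqEsubv; apply/andP; split.
    apply: minU => i; have [iF|] := boolP (i \in F); last first.
      by rewrite inE negbK => /eqP->; rewrite subrr mem0v.
    apply: memv_span; apply/tnthP; exists (enum_rank_in iF i).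
    by rewrite tnth_mktuple enum_rankK_in.
  by apply/span_subvP=> _ /tnthP[k ->]; rewrite tnth_mktuple.
suff /eqnP-> : free X by rewrite size_tuple.
apply/freeP=> c /(congr1 (fun v : 'rV_n => v 0)) c0 j.
have := congr1 (fun v => v (enum_val j)) c0; rewrite mxE summxE => <-.
have rF := enum_valP j; rewrite inE in rF.
rewrite (bigD1 j) //= big1 => [|k nkj]; rewrite nth_mktuple !mxE !eqxx /=.
  rewrite [enum_val j == r _]eq_sym (negPf rF).
  by rewrite addr0 subr0 mulr1.
rewrite (inj_eq enum_val_inj) eq_sym (negPf nkj).
case: eqP => [ej|_]; last by rewrite subrr mulr0.
by move: rF; rewrite ej rr eqxx.
Qed.

(** The sum is spanned by the differences between a point and the representative
    of its block. *)
Lemma dim_sum_irr_space Q (A : {set 'I_n}) : laminar_on A (val @: Q) ->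
  (\dim (\sum_(B in Q) irr_space R B)%VS + #|block (val @: Q) @: A| = #|A|)%N.
Proof.
move=> lQ; have lS := laminar_onW lQ; rewrite -(card_block_rep lQ).
congr (_ + _)%N; apply: dim_idempotent => [i|i|V memV].
- exact: block_rep_idem.
- have := block_rep_in (val @: Q) i; rewrite in_block => /orP[/eqP->|].
    by rewrite subrr mem0v.
  case/exists_inP=> _ /imsetP[B BQ ->] /andP[iB rB].
  apply: subvP (mem_irr_space iB rB); exact: (sumv_sup B).
apply/subv_sumP=> B BQ; apply: irr_space_sub => i j iB jB.
have -> : e i - e j = (e i - e (block_rep (val @: Q) i))
                      - (e j - e (block_rep (val @: Q) j)).
  rewrite (@block_repE _ (val @: Q) i j) ?opprB ?addrA ?subrK //.
  apply: block_eq => //; exact: (subsetP (sub_block (imset_f _ BQ) jB) _ iB).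
exact: rpredB.
Qed.

(** The family consisting of A alone has a single block in A. *)
Lemma dim_irr_space A : (\dim (irr_space R A)).+1 = #|val A|.
Proof.
have e1 : val @: [set A] = [set val A] by rewrite imset_set1.
have lA : laminar_on (val A) (val @: [set A]).
  rewrite e1; apply/andP; split; apply/forall_inP=> B /set1P->.
    by apply/forall_inP=> C /set1P->; rewrite subxx !orbT.
  by rewrite subxx (valP A).
rewrite -[RHS](dim_sum_irr_space lA) big_set1 -[LHS]addn1 e1; congr (_ + _)%N.
suff -> : block [set val A] @: val A = [set val A] by rewrite cards1.
have bA i : i \in val A -> block [set val A] i = val A.
  move=> iA; apply/eqP; rewrite eqEsubset sub_block ?set11 // andbT.
  rewrite subUset sub1set iA; by apply/bigcupsP=> B /andP[/set1P->].
apply/setP=> b; rewrite inE; apply/imsetP/eqP => [[i iA ->]|->]; first exact: bA.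
have /set0Pn[i iA] : val A != set0 by rewrite -card_gt0 ltnW ?(valP A).
by exists i; rewrite ?bA.
Qed.

Lemma nestedE S : nested S = laminar_on [set: 'I_n] (val @: S).
Proof.
rewrite /laminar_on [X in _ && X](_ : _ = true) ?andbT; last first.
  by apply/forall_inP=> _ /imsetP[A _ ->]; rewrite subsetT (valP A).
apply/forall_inP/forall_inP => [nS _ /imsetP[A AS ->]|nS A AS].
  apply/forall_inP=> _ /imsetP[B BS ->].
  exact: (forall_inP (nS A AS)).
apply/forall_inP=> B BS.
by have /forall_inP/(_ _ (imset_f val BS)) := nS _ (imset_f val AS).
Qed.

Lemma below_val S A :
  below (val @: S) (val A) = val @: [set B in S | val B \proper val A].
Proof.
apply/setP=> B; rewrite inE; apply/andP/imsetP => [[/imsetP[C CS ->] pCA]|].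
  by exists C; rewrite // inE CS.
by case=> C; rewrite inE => /andP[CS pCA] ->; rewrite imset_f.
Qed.

(** The sum over the members inside A has codimension (number of blocks) in the
    space of all functions on A, and the subspace of A has codimension 1. *)
Lemma codim_below S A : nested S ->
  (\dim (irr_space R A)
   - \dim (\sum_(B in S | (irr_space R B <= irr_space R A)%VS
                          && (irr_space R B != irr_space R A)) irr_space R B)
   = (arity (val @: S) (val A)).-1)%N.
Proof.
rewrite nestedE => lS.
rewrite (eq_bigl (fun B => B \in [set B in S | val B \proper val A])); last first.
  move=> B; rewrite !inE properEneq irr_space_mono (inj_eq (@irr_space_inj R n)).
  by rewrite -(inj_eq val_inj) [in RHS](andbC (_ != _)).
have lb : laminar_on (val A) (below (val @: S) (val A)).
  have /andP[lb sb] := lS; apply/andP; split.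
    by apply: sub_laminar lb; apply/subsetP=> B; rewrite inE => /andP[].
  apply/forall_inP=> B; rewrite inE => /andP[/(forall_inP sb)/andP[_ ->]].
  by rewrite andbT => /proper_sub.
rewrite /arity; move: lb; rewrite below_val => /dim_sum_irr_space.
have := dim_irr_space A; rewrite -!subn1.
move: (\dim (irr_space R A)) (\dim (\sum_(B in _) _)%VS) #|block _ @: _| => d s c.
move=> <-; lia.
Qed.

End Dimension.

(** * The contribution of a nested set to the Poincare polynomial *)

Section Poincare.
Variables (R : realType) (n : nat).
Variables (A : comAlgType rat) (x : A).
Implicit Types (S : {set irr n}).

Definition yuz_weight c : A := x * \sum_(0 <= i < c - 2) x ^+ i.

(** A value between 1 and c - 2 is below c - 1, the codimension of the sum of the
    children; the bound m is the n of the finite functions with values in ['I_n]. *)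
Lemma sum_yuz_weight c m : (c <= m.+1)%N ->
  \sum_(j < m | (0 < j < c.-1)%N) x ^+ j = yuz_weight c.
Proof.
move=> lecm; rewrite /yuz_weight big_distrr /=.
under [RHS]eq_bigr do rewrite -exprS.
rewrite -(big_mkord (fun j => 0 < j < c.-1)%N (fun j => x ^+ j)).
case: c lecm => [|[|[|c]]] lecm; try by rewrite big_pred0 ?big_geq // => j; lia.
transitivity (\sum_(1 <= j < c.+2) x ^+ j); last by rewrite big_add1 subn2.
rewrite [LHS](@big_cat_nat _ _ _ c.+2) //=.
rewrite [X in _ + X]big_nat_cond [X in _ + X]big_pred0 ?addr0; last by move=> j; lia.
rewrite big_ltn_cond //=.
rewrite big_nat_cond [RHS]big_nat_cond; apply: eq_bigl => j; lia.
Qed.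

(** With the support fixed the constraints on the values of f are independent,
    so the sum over f is the expansion of a product over all A of sums over the
    values at A; a non-member of S only takes the value 0. *)
Lemma sum_admissible S : nested S ->
  \sum_(f : {ffun irr n -> 'I_n} | admissible R (fun B => f B : nat)
                                   && (supp (fun B => f B : nat) == S))
     x ^+ (\sum_B f B)%N = weight yuz_weight (val @: S).
Proof.
move=> nS; pose d (B : irr n) := (arity (val @: S) (val B)).-1.
pose F (B : irr n) (j : 'I_n) : A :=
  if B \in S then (if (0 < j < d B)%N then x ^+ j else 0)
  else (j == 0%N :> nat)%:R.
transitivity (\prod_B \sum_j F B j).
  rewrite bigA_distr_bigA /= [LHS]big_mkcond; apply: eq_bigr => f _.
  rewrite (_ : _ && _ = [forall B, if B \in S then (0 < f B < d B)%N else f B == 0%N :> nat]).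
    case: forallP => [fS|nfS].
      rewrite -prodrXr; apply: eq_bigr => B _; rewrite /F.
      have := fS B; case: ifP => [_ ->//|_ /eqP f0]; by rewrite f0 expr0 eqxx.
    have /existsP[B nB] : [exists B, ~~ (if B \in S then (0 < f B < d B)%N else f B == 0%N :> nat)].
      by rewrite -negb_forall; apply/forallP.
    rewrite (bigD1 B) //= /F; case: ifP nB => _ /negPf->; by rewrite mul0r.
  apply/andP/forallP => [[adm /eqP eS] B|H].
    have := adm; rewrite /admissible eS.
    case: ifP => BS; last first.
      by move: BS; rewrite -eS inE => /negbFE.
    have fB : f B != 0%N :> nat by move: BS; rewrite -eS inE.
    case/orP=> [/forallP/(_ B)|/andP[_ /forall_inP/(_ B BS)]].
      by rewrite (negPf fB).
    by rewrite codim_below // lt0n fB.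
  have eS : supp (fun B => f B : nat) = S.
    apply/setP=> B; rewrite inE; have := H B; case: ifP => _.
      by case/andP; rewrite lt0n.
    by move/eqP->.
  rewrite eS eqxx; split=> //; apply/orP; right; rewrite eS nS /=.
  apply/forall_inP=> B BS; rewrite codim_below //.
  by have := H B; rewrite BS => /andP[].
rewrite /weight big_imset /=; last by move=> B C _ _; apply: val_inj.
rewrite [RHS]big_mkcond; apply: eq_bigr => B _; rewrite /F; case: ifP => BS.
  rewrite -big_mkcond sum_yuz_weight //.
  apply: leq_trans (leq_imset_card _ _) _; rewrite leqW //.
  by rewrite -[leqRHS]card_ord max_card.
have n_gt0 : (0 < n)%N.
  by rewrite -[n]card_ord (leq_trans _ (max_card (mem (val B)))) // ltnW ?(valP B).
rewrite (bigD1 (Ordinal n_gt0)) //= big1 ?addr0 // => j.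
by rewrite -val_eqE /= => /negPf->.
Qed.

End Poincare.

Lemma sum_Pnest (R : realType) n k :
  \sum_(S : {set irr n} | nested S && (#|S| == k)) Pnest R S
  = \sum_(S : {set {set 'I_n}} | laminar_on [set: 'I_n] S && (#|S| == k))
      weight (yuz_weight q) S.
Proof.
rewrite [RHS](reindex_onto (fun S : {set irr n} => val @: S)
                     (fun S => [set A : irr n | val A \in S])) /=; last first.
  move=> S /andP[/andP[_ /forall_inP lS] _]; apply/setP=> A.
  apply/imsetP/idP => [[B]|BS]; first by rewrite inE => BS ->.
  have /andP[_ A1] := lS A BS.
  by exists (exist _ A A1 : irr n); rewrite ?inE.
apply: eq_big => [S|S /andP[nS _]]; last exact: (sum_admissible _ q).
rewrite nestedE card_imset; last exact: val_inj.
rewrite [X in _ = _ && X](_ : _ = true) ?andbT //.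
apply/eqP/setP=> A; rewrite inE; apply/imsetP/idP => [[B BS /val_inj->]//|BS].
by exists A.
Qed.

(** * The series Psi *)

Lemma yuz_weight_small (A : comAlgType rat) (x : A) c :
  (c <= 2)%N -> yuz_weight x c = 0.
Proof. by move=> c2; rewrite /yuz_weight big_geq ?mulr0 //; lia. Qed.

(** The coefficient of t^N only depends on the factors with i <= N, since the
    exponent of the others has no term up to t^N. *)
Lemma prod_exp_cvg (A : comAlgType rat) (x c : A) :
  fps_cvg (fun m => \prod_(3 <= i < m)
             fps_exp (((i`!%:R^-1 : rat) *: (c * x * \sum_(0 <= j < i - 2) x ^+ j)) *: fps_t ^+ i))
    (fps_exp (c *: egf (yuz_weight x))).
Proof.
move=> N; exists N.+1 => m ltNm.
pose F i : fps A := ((i`!%:R^-1 : rat) *: (c * x * \sum_(0 <= j < i - 2) x ^+ j)) *: fps_t ^+ i.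
have F0 i : F i 0%N = 0.
  rewrite /F fps_coefZ fps_coef_tX.
  by case: i => [|i]; rewrite ?mulr0 // big_geq // mulr0 scaler0 mul0r.
rewrite (@fps_exp_sum _ _ _ F F0); apply: eq_fps_exp => i leiN.
rewrite fps_coef_sum /F; under eq_bigr do rewrite fps_coefZ fps_coef_tX.
rewrite fps_coefZ /egf.
have [i3|i3] := leqP 3 i.
  rewrite (bigD1_seq i) ?mem_index_iota ?iota_uniq //=; last by lia.
  rewrite eqxx mulr1 [X in _ + X]big1 ?addr0 => [|j /negPf nji].
    by rewrite -scalerAr /yuz_weight mulrA.
  by rewrite eq_sym nji mulr0.
rewrite yuz_weight_small ?scaler0 ?mulr0; last by lia.
rewrite big_nat big1 // => j /andP[j3 _].
by rewrite (_ : (i == j) = false) ?mulr0 //; lia.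
Qed.

(** Only the nested sets with k = N+1-n elements contribute to t^N, so N and n fix
    k and [nested_sum_exp] applies. *)
Lemma Psi_term_coef (R : realType) n N : (0 < n <= N.+1)%N ->
  Psi_term R n N =
  ((N.+1 - n)`!%:R^-1 : rat) *:
    ((fps_exp fps_t * egf (yuz_weight q) ^+ (N.+1 - n)) N * z ^+ (N.+1 - n)).
Proof.
move=> /andP[n0 nN]; set k := (N.+1 - n)%N.
rewrite scalerAl -(@nested_sum_exp _ (yuz_weight q) _ _ _ [set: 'I_n] k N).
- rewrite -(sum_Pnest R) /Psi_term fps_coef_sum -scalerAl mulr_suml scaler_sumr.
  rewrite [LHS]big_mkcond [RHS]big_mkcond; apply: eq_bigr => S _.
  case: (nested S) => //=; rewrite fps_coefZ fps_coef_tX.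
  rewrite (_ : (#|S| == k) = (N == n + #|S| - 1)%N); last first.
    by move: #|S| => s; rewrite /k; lia.
  case: eqP => [eN|_]; last by rewrite mulr0.
  have -> : k = #|S| by move: #|S| eN => s; rewrite /k; lia.
  by rewrite mulr1 -eN.
- exact: yuz_weight_small.
- exact: yuz_weight_small.
by rewrite cardsT card_ord /k; lia.
Qed.

(** Passing from the number k of elements of a nested set to n = N+1-k.  Psi sums
    over n >= 2, so the term n = 1, that is k = N, has to be matched with the
    constant term of Psi. *)
Lemma sum_rev_recl (V : nmodType) (u : nat -> V) N :
  \sum_(0 <= k < N.+1) u k = u N + \sum_(2 <= n < N.+2) u (N.+1 - n)%N.
Proof.
rewrite big_nat_rev big_ltn //= add0n subSS subn0 [in RHS]big_add1.
by congr (_ + _); apply: eq_bigr => i _; rewrite !subSS.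
Qed.

(* The infinite product is the t-adic limit G of its partial products. *)
Theorem theorem10p1 (R : realType) :
  exists2 G : fps Qqz,
    fps_cvg (fun m => \prod_(3 <= i < m)
               fps_exp ((i`!%:R^-1 *: (z * q * qint (i - 2))) *: fps_t ^+ i)) G
    & Psi R = fps_exp fps_t * G.
Proof.
exists (fps_exp (z *: egf (yuz_weight q))); first exact: (prod_exp_cvg q z).
apply/funext=> N; rewrite fps_expM_exp; last first.
  by rewrite /egf yuz_weight_small ?scaler0.
rewrite sum_rev_recl /Psi fps_coefD fps_coef_sum; congr (_ + _); last first.
  rewrite [LHS]big_nat [RHS]big_nat; apply: eq_bigr => n nN.
  by rewrite Psi_term_coef //; lia.
(* The term k = N is zero for N > 0, as phi^N starts at t^(2N). *)
have small : forall c, (c < 2)%N -> egf (yuz_weight q) c = 0.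
  by apply: egf_val; apply: yuz_weight_small.
case: N => [|N]; last by rewrite (fps_coef_mulX0 _ small) ?mul0r ?scaler0 //; lia.
by rewrite !expr0 !mulr1 fps_exp_coef0 fact0 invr1 scale1r.
Qed.
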